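(* Let $X$ be a Hilbert space and let $T\in B(X)$ have a $\{1,3,7\}$-inverse $T^{\{1,3,7\}}\in B(X)$. Let $\delta T\in B(X)$ be such that $I+T^{\{1,3,7\}}\delta T: X\to X$ is invertible, and put $\overline{T}=T+\delta T$. Then, for the operator $$B=T^{\{1,3,7\}}(I+\delta T\,T^{\{1,3,7\}})^{-1}=(I+T^{\{1,3,7\}}\delta T)^{-1}T^{\{1,3,7\}}$$ (both expressions being well defined and equal), the following conditions are equivalent: (i) $B$ is a $\{1,3,7\}$-inverse of $\overline{T}$; (ii) $R(\overline{T})\subseteq R(T)$; (iii) $R(\overline{T})=R(T)$; (iv) $TT^{\{1,3,7\}}\overline{T}=\overline{T}$; (v) $TT^{\{1,3,7\}}\delta T=\delta T$. In this case, $\overline{T}B=TT^{\{1,3,7\}}$, $$\|B\|\le \|T^{\{1,3,7\}}\|\cdot\|(I+T^{\{1,3,7\}}\delta T)^{-1}\|,$$ and $$\|B-T^{\{1,3,7\}}\|\le \|T^{\{1,3,7\}}\|\cdot\|(I+T^{\{1,3,7\}}\delta T)^{-1}\|\cdot\|T^{\{1,3,7\}}\delta T\|.$$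
   Context: $B(X)$ is the Banach space of all bounded linear operators from the Hilbert space $X$ into itself, with the operator norm; $I$ is the identity operator; $R(A)$ denotes the range of $A$; $A^*$ is the Hilbert space adjoint. For $A\in B(X)$, an operator $S\in B(X)$ is called a $\{1,3,7\}$-inverse of $A$ if it satisfies the three equations (1) $ASA=A$, (3) $(AS)^*=AS$, (7) $AS^2=S$. The symbol $T^{\{1,3,7\}}$ denotes a fixed $\{1,3,7\}$-inverse of $T$. *)

(* Defs.v *)
From HB Require Import structures.
From mathcomp Require Import all_boot all_order all_algebra sesquilinear complex.
From mathcomp Require Import boolp classical_sets functions reals.
From mathcomp Require Import topology normedtype.

Set Implicit Arguments.
Unset Strict Implicit.
Unset Printing Implicit Defensive.
Import Order.TTheory GRing.Theory Num.Theory.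
Import numFieldNormedType.Exports.
Local Open Scope ring_scope.
Local Open Scope classical_set_scope.

(** Hilbert spaces are taken over either the real or the complex numbers. *)

Inductive field_kind := RealScalars | ComplexScalars.

Definition scalar (R : realType) (k : field_kind) : numFieldType :=
  match k with
  | RealScalars => R
  | ComplexScalars => R[i]
  end.

Definition scalar_conj (R : realType) (k : field_kind) :
    scalar R k -> scalar R k :=
  match k with
  | RealScalars => idfun
  | ComplexScalars => Num.conj
  end.

Definition scalar_Re (R : realType) (k : field_kind) : scalar R k -> R :=
  match k with
  | RealScalars => idfun
  | ComplexScalars => @complex.Re R
  end.

Record hilbertType (R : realType) (k : field_kind) := HilbertType {
  hilbert_sort :> completeNormedModType (scalar R k);
  inner : {dot hilbert_sort for @scalar_conj R k};
  sqr_norm_inner : forall x : hilbert_sort, `|x| ^+ 2 = inner x x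
}.

Arguments inner {R k h}.

Record bounded_op (R : realType) (k : field_kind) (X : hilbertType R k) :=
  BoundedOp {
    bop_val :> {linear X -> X};
    bop_bounded : exists M, forall x : X, `|bop_val x| <= M * `|x|
  }.

Notation "''B' ( X )" := (bounded_op X) (format "''B' ( X )") : type_scope.

Section BoundedOpRing.
Context {R : realType} {k : field_kind} {X : hilbertType R k}.
Implicit Types A B C : 'B(X).

HB.instance Definition _ := gen_eqMixin 'B(X).
HB.instance Definition _ := gen_choiceMixin 'B(X).

Lemma bop_ext A B : (forall x, A x = B x) -> A = B.
Proof.
case: A B => [f fb] [g gb] /= fg.
have e : f = g.
  case: f g fg {fb gb} => [f cf] [g cg] /= /funext fg.
  case: _ / fg cg => cg; congr GRing.Linear.Pack.
  case: cf cg => [[a1] [b1]] [[a2] [b2]].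
  by rewrite (Prop_irrelevance a1 a2) (Prop_irrelevance b1 b2).
by case: _ / e gb => gb; rewrite (Prop_irrelevance fb gb).
Qed.

Lemma bop_bound_ge0 A :
  exists2 M, 0 <= M & forall x : X, `|A x| <= M * `|x|.
Proof.
have [M AM] := bop_bounded A.
have [[x x0]|X0] := pselect (exists x : X, x != 0).
  exists M => //; rewrite -(pmulr_lge0 _ (_ : 0 < `|x|)) ?normr_gt0//.
  exact: le_trans (AM x).
exists 0 => // x; have /eqP -> : x == 0 by apply/negPn/negP => ?; apply: X0; exists x.
by rewrite linear0 !normr0 mulr0.
Qed.

Lemma bop_zero_bounded :
  exists M, forall x : X, `|(\0%R : {linear X -> X}) x| <= M * `|x|.
Proof. by exists 0 => x; rewrite /= normr0 mul0r. Qed.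

Lemma bop_one_bounded :
  exists M, forall x : X, `|(idfun : {linear X -> X}) x| <= M * `|x|.
Proof. by exists 1 => x; rewrite /= mul1r. Qed.

Lemma bop_opp_bounded A :
  exists M, forall x : X, `|(\- A : {linear X -> X}) x| <= M * `|x|.
Proof. by have [M AM] := bop_bounded A; exists M => x; rewrite /= normrN. Qed.

Lemma bop_add_bounded A B :
  exists M, forall x : X, `|(A \+ B : {linear X -> X}) x| <= M * `|x|.
Proof.
have [M AM] := bop_bounded A; have [N BN] := bop_bounded B.
by exists (M + N) => x; rewrite mulrDl (le_trans (ler_normD _ _))// lerD.
Qed.

Lemma bop_mul_bounded A B :
  exists M, forall x : X, `|(A \o B : {linear X -> X}) x| <= M * `|x|.
Proof.
have [M M0 AM] := bop_bound_ge0 A; have [N BN] := bop_bounded B.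
exists (M * N) => x; rewrite /= (le_trans (AM _))// -mulrA.
exact: ler_wpM2l.
Qed.

Definition bop_zero : 'B(X) := BoundedOp bop_zero_bounded.
Definition bop_one : 'B(X) := BoundedOp bop_one_bounded.
Definition bop_opp A : 'B(X) := BoundedOp (bop_opp_bounded A).
Definition bop_add A B : 'B(X) := BoundedOp (bop_add_bounded A B).
Definition bop_mul A B : 'B(X) := BoundedOp (bop_mul_bounded A B).

Lemma bop_addA : associative bop_add.
Proof. by move=> A B C; apply: bop_ext => x /=; rewrite addrA. Qed.
Lemma bop_addC : commutative bop_add.
Proof. by move=> A B; apply: bop_ext => x /=; rewrite addrC. Qed.
Lemma bop_add0 : left_id bop_zero bop_add.
Proof. by move=> A; apply: bop_ext => x /=; rewrite add0r. Qed.
Lemma bop_addN : left_inverse bop_zero bop_opp bop_add.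
Proof. by move=> A; apply: bop_ext => x /=; rewrite addNr. Qed.

HB.instance Definition _ :=
  GRing.isZmodule.Build 'B(X) bop_addA bop_addC bop_add0 bop_addN.

Lemma bop_mulA : associative bop_mul.
Proof. by move=> A B C; apply: bop_ext. Qed.
Lemma bop_mul1 : left_id bop_one bop_mul.
Proof. by move=> A; apply: bop_ext. Qed.
Lemma bop_mulr1 : right_id bop_one bop_mul.
Proof. by move=> A; apply: bop_ext. Qed.
Lemma bop_mulDl : left_distributive bop_mul +%R.
Proof. by move=> A B C; apply: bop_ext. Qed.
Lemma bop_mulDr : right_distributive bop_mul +%R.
Proof. by move=> A B C; apply: bop_ext => x /=; rewrite linearD. Qed.

(* A possibly trivial ring, since [X] may be the zero space. *)
HB.instance Definition _ :=
  GRing.Zmodule_isPzRing.Build 'B(X)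
    bop_mulA bop_mul1 bop_mulr1 bop_mulDl bop_mulDr.

(* The norm of [X] takes its values in the scalar field, hence [scalar_Re]. *)
Definition opnorm A : R :=
  sup [set scalar_Re `|A x| | x in [set x : X | `|x| <= 1]].

Definition is_adjoint A B := forall x y : X, inner (A x) y = inner x (B y).

(* On a Hilbert space the operator [B] below exists (Riesz) and is unique. *)
Definition adjoint A : 'B(X) := xget 0 [set B | is_adjoint A B].

Definition is_inverse A B := A * B = 1 /\ B * A = 1.

Definition invertible A := exists B, is_inverse A B.

(* Meaningful only when [A] is invertible. *)
Definition opinv A : 'B(X) := xget 0 [set B | is_inverse A B].

(* [A * B] is composition, so [S ^+ 2] is [S \o S] and [1] the identity. *)
Definition is_137_inverse A S :=
  [/\ A * S * A = A, adjoint (A * S) = A * S & A * S ^+ 2 = S].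

End BoundedOpRing.

(* Main.v *)
Require Import Defs.
From mathcomp Require Import all_boot all_order all_algebra.
From mathcomp Require Import classical_sets reals.
From mathcomp Require Import complex normedtype.

Set Implicit Arguments.
Unset Strict Implicit.
Unset Printing Implicit Defensive.
Import Order.TTheory GRing.Theory Num.Theory.
Local Open Scope ring_scope.
Local Open Scope classical_set_scope.

(** Put P = T * S, D = 1 + S * dT, W = D^-1 and F = Tbar * B. Everything turns
on the factorisation Tbar = T * D. Since P * T = T, the product P * Tbar is
T * D for every dT ([proj_perturbed]), so the factorisation says that P fixes
Tbar, or equivalently dT; as D is invertible and P is a projection onto the
range of T, it also says that the range of Tbar is contained in, or equal to,
that of T.

If the factorisation holds, then B = W * S gives F = T * D * W * S = P, and the
three equations for B follow from those for S ([perturbed_factor_137]).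

The remaining implication, that the factorisation holds as soon as B is a
{1,3,7}-inverse of Tbar, is the substantial one ([perturbed_137_factor]). In
any case P * F = T * D * W * S = P. Now P and F are both self-adjoint, so
F * P = P as well ([selfadjoint_absorb]), whence F * T = F * P * T = T. With
W = 1 - W * S * dT and F * Tbar = Tbar this yields
  Tbar * W = Tbar - F * dT = Tbar - F * Tbar + F * T = T,
that is, Tbar = T * D.

The norm estimates are submultiplicativity of the operator norm
([opnormM_le]), applied to B = W * S and to B - S = - (W * (S * dT) * S). *)

(** * Inverses of 1 + A * B and 1 + B * A *)

Section Algebra.
Variables (R : realType) (k : field_kind) (X : hilbertType R k).
Implicit Types A B W V : 'B(X).

Lemma opinvP A : invertible A -> is_inverse A (opinv A).
Proof. by case=> B AB; apply: (xgetPex 0); exists B. Qed.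

(** The geometric series suggests the formula: the powers of - (B * A) sum to
1 - B * (1 - A * B + ...) * A. *)
Lemma is_inverse_swap A B W :
  is_inverse (1 + A * B) W -> is_inverse (1 + B * A) (1 - B * W * A).
Proof.
move=> [DW WD]; split.
- rewrite mulrBr mulr1.
  have -> : (1 + B * A) * (B * W * A) = B * ((1 + A * B) * W) * A.
    by rewrite !mulrA mulrDl mul1r mulrDr mulr1 !mulrA.
  by rewrite DW mulr1 addrK.
- rewrite mulrBl mul1r.
  have -> : B * W * A * (1 + B * A) = B * (W * (1 + A * B)) * A.
    by rewrite !mulrDr !mulr1 mulrDl !mulrA.
  by rewrite WD mulr1 addrK.
Qed.

Lemma inverse_intertwine A B W V :
  is_inverse (1 + A * B) W -> is_inverse (1 + B * A) V -> A * V = W * A.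
Proof.
move=> [_ WD] [EV _].
have DA : (1 + A * B) * A = A * (1 + B * A).
  by rewrite mulrDl mulrDr mul1r mulr1 mulrA.
by rewrite -[A in LHS]mul1r -WD -(mulrA W) DA -!mulrA EV mulr1.
Qed.

Lemma range_mul_sub A B : range (A * B) `<=` range A.
Proof. by move=> _ [x _ <-]; exists (B x). Qed.

End Algebra.

(** * Self-adjoint operators *)

Section Adjoint.
Variables (R : realType) (k : field_kind) (X : hilbertType R k).
Implicit Types A P F : 'B(X).

(** If no adjoint exists, [adjoint A] is the default value 0; then the
hypothesis says A = 0, which is self-adjoint anyway. *)
Lemma is_adjoint_id A : adjoint A = A -> is_adjoint A A.
Proof.
rewrite /adjoint; case: xgetP => [B _ AB BA | _ <- x y]; first by rewrite BA in AB.
by rewrite /= linear0l linear0r.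
Qed.

Lemma inner_eq0 (z : X) : (forall y, inner z y = 0) -> z = 0.
Proof.
move=> z0; apply/eqP; rewrite -normr_eq0 -sqrf_eq0.
by rewrite sqr_norm_inner z0.
Qed.

(** Take adjoints of both sides of P * F = P. *)
Lemma selfadjoint_absorb P F :
  is_adjoint P P -> is_adjoint F F -> P * F = P -> F * P = P.
Proof.
move=> Pa Fa PF; apply: bop_ext => x; apply/eqP; rewrite -subr_eq0; apply/eqP.
apply: inner_eq0 => y.
by rewrite linearBl /= Fa !Pa -[P (F y)]/((P * F) y) PF subrr.
Qed.

End Adjoint.

(** * The operator norm *)

Section OperatorNorm.
Variables (R : realType) (k : field_kind) (X : hilbertType R k).
Implicit Types A B : 'B(X).

Lemma scalar_Re_le (a b : Defs.scalar R k) :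
  a <= b -> scalar_Re a <= scalar_Re b.
Proof. by case: k a b => //= a b; rewrite lecE => /andP[]. Qed.

Lemma scalar_ReM (a b : Defs.scalar R k) :
  a \is Num.real -> b \is Num.real ->
  scalar_Re (a * b) = scalar_Re a * scalar_Re b.
Proof.
case: k a b => //= a b ra rb.
by rewrite -(RRe_real ra) -(RRe_real rb) -rmorphM.
Qed.

Lemma scalar_Re0 : scalar_Re (0 : Defs.scalar R k) = 0.
Proof. by case: k. Qed.

Lemma scalar_Re_norm_ge0 (x : X) : 0 <= scalar_Re `|x|.
Proof. by rewrite -scalar_Re0; apply: scalar_Re_le. Qed.

Lemma opnorm_bound A (x : X) : `|x| <= 1 -> scalar_Re `|A x| <= opnorm A.
Proof.
move=> x1; apply: ub_le_sup; last by exists x.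
have [M M0 AM] := bop_bound_ge0 A.
exists (scalar_Re M) => _ [y y1 <-]; apply: scalar_Re_le.
by rewrite (le_trans (AM y))// ler_piMr.
Qed.

Lemma opnorm_le A (c : R) :
  (forall x : X, `|x| <= 1 -> scalar_Re `|A x| <= c) -> opnorm A <= c.
Proof.
move=> Ac; apply: ge_sup => [|_ [x x1 <-]]; last exact: Ac.
by exists (scalar_Re `|A 0|), 0 => //=; rewrite normr0.
Qed.

Lemma opnorm_ge0 A : 0 <= opnorm A.
Proof.
apply: le_trans (scalar_Re_norm_ge0 (A 0)) _.
by apply: opnorm_bound; rewrite normr0.
Qed.

(** For x <> 0, compare with the unit vector y in the direction of x. The norms
are real scalars, so taking real parts respects the product |A y| * |x|. *)
Lemma opnorm_apply_le A (x : X) :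
  scalar_Re `|A x| <= opnorm A * scalar_Re `|x|.
Proof.
have [->|x0] := eqVneq x 0; first by rewrite linear0 normr0 scalar_Re0 mulr0.
pose y := `|x|^-1 *: x.
have nx0 : `|x| != 0 by rewrite normr_eq0.
have y1 : `|y| <= 1.
  by rewrite normrZ normfV normr_id mulVf.
have -> : `|A x| = `|A y| * `|x|.
  by rewrite linearZ normrZ normfV normr_id mulrAC mulVf// mul1r.
rewrite scalar_ReM ?normr_real// ler_wpM2r ?scalar_Re_norm_ge0//.
exact: opnorm_bound.
Qed.

Lemma opnormM_le A B : opnorm (A * B) <= opnorm A * opnorm B.
Proof.
apply: opnorm_le => x x1; apply: le_trans (opnorm_apply_le A (B x)) _.
by rewrite ler_wpM2l ?opnorm_ge0// opnorm_bound.
Qed.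

Lemma opnormN A : opnorm (- A) = opnorm A.
Proof.
by congr sup; apply/seteqP; split=> _ [x x1 <-]; exists x => //=; rewrite normrN.
Qed.

End OperatorNorm.

(** * The perturbed inverse *)

Section Perturbation.
Variables (R : realType) (k : field_kind) (X : hilbertType R k).
Variables (T S dT W : 'B(X)).
Hypotheses (TST : T * S * T = T) (TSS : T * S ^+ 2 = S).
Hypothesis TSadj : adjoint (T * S) = T * S.
Hypothesis invW : is_inverse (1 + S * dT) W.

(** The projection T * S onto the range of T cuts T + dT down to a product
with the invertible factor 1 + S * dT, whatever dT is. *)
Lemma proj_perturbed : T * S * (T + dT) = T * (1 + S * dT).
Proof. by rewrite mulrDr TST mulrDr mulr1 mulrA. Qed.

Lemma perturbed_factor_iff :
  T + dT = T * (1 + S * dT) <-> T * S * dT = dT.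
Proof. by rewrite mulrDr mulr1 mulrA; split=> [/addrI|->]. Qed.

(** Self-adjointness turns P * F = P into F * P = P, and the latter makes F fix
T, hence also dT = Tbar - T. *)
Lemma perturbed_137_factor :
  is_137_inverse (T + dT) (W * S) -> T + dT = T * (1 + S * dT).
Proof.
move=> [FTbar Fadj _]; have [DW WD] := invW.
set F := (T + dT) * (W * S) in FTbar Fadj.
have PF : T * S * F = T * S.
  by rewrite /F mulrA proj_perturbed -mulrA [_ * (W * S)]mulrA DW mul1r.
have FP : F * (T * S) = T * S.
  by apply: selfadjoint_absorb PF; apply: is_adjoint_id.
have FT : F * T = T by rewrite -[in LHS]TST mulrA FP.
have FdT : F * dT = dT by move: FTbar; rewrite mulrDr FT => /addrI.
have TbarW : (T + dT) * W = T.
  have -> : W = 1 - W * (S * dT).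
    by apply/eqP; rewrite eq_sym subr_eq -{1}[W]mulr1 -mulrDr WD.
  by rewrite mulrBr mulr1 !mulrA -[_ * W * S]mulrA FdT addrK.
by rewrite -[in RHS]TbarW -mulrA WD mulr1.
Qed.

Lemma perturbed_product :
  T + dT = T * (1 + S * dT) -> (T + dT) * (W * S) = T * S.
Proof.
by move=> ->; have [DW _] := invW; rewrite -mulrA [_ * (W * S)]mulrA DW mul1r.
Qed.

(** The range of W * S lies in that of S, because W * S = S * V with V the
inverse of 1 + dT * S; this is what lets T * S fix W * S. *)
Lemma perturbed_factor_137 :
  T + dT = T * (1 + S * dT) -> is_137_inverse (T + dT) (W * S).
Proof.
move=> fac; have TbarB := perturbed_product fac.
have TS_S : T * S * S = S by rewrite -mulrA -expr2.
split; rewrite ?TbarB //; first by rewrite proj_perturbed.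
rewrite expr2 mulrA TbarB.
by rewrite -(inverse_intertwine invW (is_inverse_swap invW)) mulrA TS_S.
Qed.

End Perturbation.

Theorem theorem2p1 (R : realType) (k : field_kind) (X : hilbertType R k)
    (T S dT : 'B(X))
    (hS : is_137_inverse T S)
    (hinv : invertible (1 + S * dT)) :
  let Tbar := T + dT in
  let B := S * opinv (1 + dT * S) in
  [/\ invertible (1 + dT * S),
      B = opinv (1 + S * dT) * S,
      [<-> is_137_inverse Tbar B;
           range Tbar `<=` range T;
           range Tbar = range T;
           T * S * Tbar = Tbar;
           T * S * dT = dT] &
      is_137_inverse Tbar B ->
      [/\ Tbar * B = T * S,
          opnorm B <= opnorm S * opnorm (opinv (1 + S * dT)) &
          opnorm (B - S) <=
            opnorm S * opnorm (opinv (1 + S * dT)) * opnorm (S * dT)]].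
Proof.
have [TST TSadj TSS] := hS.
have invW := opinvP hinv; have invV := is_inverse_swap invW.
have hV : invertible (1 + dT * S) by exists (1 - dT * opinv (1 + S * dT) * S).
move=> Tbar B.
have BW : B = opinv (1 + S * dT) * S.
  exact: inverse_intertwine invW (opinvP hV).
rewrite BW; set W := opinv (1 + S * dT) in invW *; have [DW WD] := invW.
have factor : is_137_inverse Tbar (W * S) -> Tbar = T * (1 + S * dT).
  exact: perturbed_137_factor.
split=> //.
- tfae.
  + by move=> /factor ->; apply: range_mul_sub.
  + move=> sub; apply/seteqP; split=> //.
    have PTbar : T * S * Tbar = Tbar.
      apply: bop_ext => x; have [y _ Ty] := sub _ (ex_intro2 _ _ x I erefl).
      by rewrite -[LHS]/(T (S (Tbar x))) -Ty -[LHS]/((T * S * T) y) TST.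
    have -> : T = Tbar * W.
      by rewrite -PTbar (proj_perturbed _ TST) -mulrA DW mulr1.
    exact: range_mul_sub.
  + move=> eqR; apply: bop_ext => x.
    have [y _ Ty] : range T (Tbar x) by rewrite -eqR; exists x.
    by rewrite -[LHS]/(T (S (Tbar x))) -Ty -[LHS]/((T * S * T) y) TST.
  + by rewrite proj_perturbed// => /esym /perturbed_factor_iff.
  + by move=> /perturbed_factor_iff; apply: perturbed_factor_137.
- move=> /factor fac; split.
  + exact: perturbed_product.
  + by rewrite [leRHS]mulrC opnormM_le.
  + have -> : W * S - S = - (W * (S * dT) * S).
      by rewrite -{2}[S]mul1r -WD mulrDr mulr1 mulrDl opprD addrA subrr add0r.
    rewrite opnormN -[leRHS]mulrA [leRHS]mulrC.
    apply: le_trans (opnormM_le _ _) _.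
    by rewrite ler_wpM2r ?opnorm_ge0 ?opnormM_le.
Qed.
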